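(* Let $E$ be a finite set with $n=|E|$ elements and let $\nu\colon 2^E\to\mathbb{R}\cup\{-\infty\}$ be an $\mathrm{M}^\natural$-concave function. For $0\le k\le n$ and $0<q\le1$ set $I_{q,\nu;k}(\mathbf{x})=\sum_{S\subseteq E,\,|S|=k} q^{-\nu(S)}\mathbf{x}^S$ with $\mathbf{x}^S=\prod_{i\in S}x_i$. Then for all $0<k<n$ and $0<q\le1$ we have the coefficientwise inequality \[ I_{q,\nu;k}(\mathbf{x})^2\succeq \Big(1+\frac1k\Big)I_{q,\nu;k-1}(\mathbf{x})\,I_{q,\nu;k+1}(\mathbf{x}). \]
   Context: A function $\nu\colon 2^E\to\mathbb{R}\cup\{-\infty\}$ is $\mathrm{M}^\natural$-concave if for any $I_1,I_2\subseteq E$ and $i_1\in I_1\setminus I_2$, either $\nu(I_1)+\nu(I_2)\le \nu(I_1\setminus i_1)+\nu(I_2\cup i_1)$, or there is $i_2\in I_2\setminus I_1$ with $\nu(I_1)+\nu(I_2)\le \nu((I_1\setminus i_1)\cup i_2)+\nu((I_2\setminus i_2)\cup i_1)$; its effective domain $\{S:\nu(S)\ne-\infty\}$ is assumed nonempty. Convention $q^{\infty}=0$. For real polynomials $f,g$ in the variables $(x_i)_{i\in E}$, $f\succeq g$ means every coefficient of $f-g$ is nonnegative. *)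

(* Defs.v *)
From mathcomp Require Import all_boot all_algebra.
From mathcomp Require Import Rstruct.
From mathcomp Require Import mpoly.
From Stdlib Require Rpower.

Set Implicit Arguments.
Unset Strict Implicit.
Unset Printing Implicit Defensive.

Import GRing.Theory Num.Theory.
Local Open Scope ring_scope.

Notation R := Rdefinitions.R.

(* R ∪ {-oo}, with [None] standing for -oo. *)
Definition extR := option R.

Definition eadd (a b : extR) : extR :=
  match a, b with Some x, Some y => Some (x + y) | _, _ => None end.

Definition ele (a b : extR) : Prop :=
  match a, b with
  | None, _ => True
  | Some _, None => False
  | Some x, Some y => x <= y
  end.

Definition Mnat_concave (E : finType) (nu : {set E} -> extR) : Prop :=
  forall (I1 I2 : {set E}) (i1 : E), i1 \in I1 :\: I2 ->
    ele (eadd (nu I1) (nu I2)) (eadd (nu (I1 :\ i1)) (nu (i1 |: I2)))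
    \/ exists2 i2, i2 \in I2 :\: I1 &
         ele (eadd (nu I1) (nu I2))
             (eadd (nu (i2 |: (I1 :\ i1))) (nu (i1 |: (I2 :\ i2)))).

Definition dom_nonempty (E : finType) (nu : {set E} -> extR) : Prop :=
  exists S, nu S <> None.

(* q^{-v}, with the convention q^{-(-oo)} = q^{oo} = 0 *)
Definition qpow (q : R) (v : extR) : R :=
  match v with Some x => Rpower.Rpower q (- x) | None => 0 end.

Definition Ipoly (n : nat) (q : R) (nu : {set 'I_n} -> extR) (k : nat)
  : {mpoly R[n]} :=
  \sum_(S : {set 'I_n} | #|S| == k) qpow q (nu S) *: \prod_(i in S) 'X_i.

Definition coef_ge (n : nat) (f g : {mpoly R[n]}) : Prop :=
  forall m : 'X_{1..n}, g@_m <= f@_m.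

(* Main.v *)
Require Import Defs.
From mathcomp Require Import all_boot all_algebra.
From mathcomp Require Import Rstruct.
From mathcomp Require Import mpoly.
From mathcomp Require Import all_order ring lra zify.
Import GRing.Theory Num.Theory.
Import Order.TTheory.
Local Open Scope ring_scope.

Set Implicit Arguments.
Unset Strict Implicit.
Unset Printing Implicit Defensive.

(* Put w(S) = q^-nu(S). The coefficient of x^m vanishes on both sides unless all
   exponents are at most 2; then, with A = {m = 2} and U = {m >= 1}, it is the sum
   of w(S) w(S') over A <= S <= U of the right size, where S' is A together with
   U \ S. Put r = k - |A| and f(x, y) = sum_(A <= S <= U) w(S) x^(S \ A) y^|U \ S|.
   The two sums are, up to constants, the entries of the Hessian H in (y, z) of
     (d/dy)^(r-1) (d/dz)^(r-1) prod_(i in U \ A) (d/dx_i + d/dx'_i)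
   applied to f(x, y) f(x', z), so the inequality says det H <= 0, which holds if
   the form has at most one positive eigenvalue.
   This is proved for the Hessian in all variables by induction on the number of
   factors d/dx_i + d/dx'_i. Expanding one of them gives two forms M1 (derivative
   in x_i) and M2 (derivative in x'_i); e'_i is isotropic for M1, e_i is isotropic
   for M2, and M1(e'_i, .) = M2(e_i, .), so both are nonpositive on one common
   hyperplane as soon as this functional is nonzero. Without such factors the
   form is a product of two linear forms, or a quadratic derivative of f, whose
   signature amounts to an inequality for ultrametric matrices.
   Nondegeneracy is ensured by a perturbation making w positive everywhere. *)

(** * Symmetric bilinear forms with at most one positive eigenvalue *)

Section HyperbolicForms.
Variables (F : realFieldType) (X : Type).
Implicit Types (u v g e : X -> F) (B : (X -> F) -> (X -> F) -> F).

Definition axpy (a : F) u v : X -> F := fun x => a * u x + v x.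

Definition symbil B :=
  (forall u v, B u v = B v u) /\
  (forall a u v g, B (axpy a u v) g = a * B u g + B v g).

(** Reverse Cauchy-Schwarz inequality: for a symmetric bilinear form it says that no plane is
    positive definite. *)
Definition hyperbolic B :=
  forall u v, 0 < B u u -> B u u * B v v <= B u v ^+ 2.

Lemma symbil_axpy B a u v : symbil B ->
  B (axpy a u v) (axpy a u v) = a ^+ 2 * B u u + 2 * a * B u v + B v v.
Proof.
move=> [symB linB]; rewrite linB (symB u) (symB v) !linB (symB v u); ring.
Qed.

Lemma hyperbolic_functional B (l : (X -> F) -> F) : symbil B ->
  (forall a u v, l (axpy a u v) = a * l u + l v) ->
  (forall u, l u = 0 -> B u u <= 0) -> hyperbolic B.
Proof.
move=> bB linl neg u v Buu.
have lu0 : l u != 0 by apply: contraTneq Buu => /neg; rewrite leNgt.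
(* The plane spanned by [u] and [v] meets the kernel of [l] in this vector. *)
have /neg : l (axpy (- l v / l u) u v) = 0 by rewrite linl; field.
rewrite symbil_axpy //; set t := _ / _ => Bz.
have : B u u * (t ^+ 2 * B u u + 2 * t * B u v + B v v) <= 0.
  by rewrite pmulr_rle0.
have := sqr_ge0 (t * B u u + B u v); nra.
Qed.

(** If [B u u] were positive, adding multiples of [e] to [g] would make [B g g] arbitrarily large
    without changing [B u g], against the reverse Cauchy-Schwarz inequality. *)
Lemma hyperbolic_isotropic B e g u : symbil B -> hyperbolic B ->
  B e e = 0 -> B e g != 0 -> B e u = 0 -> B u u <= 0.
Proof.
move=> bB hB Bee Beg Beu; have [symB linB] := bB.
rewrite leNgt; apply/negP => Buu.
pose t := (B u g ^+ 2 / B u u + 1 - B g g) / (2 * B e g).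
have := hB u (axpy t e g) Buu.
rewrite symbil_axpy // Bee (symB u) linB Beu (symB g u) mulr0 !add0r mulr0 add0r.
have -> : 2 * t * B e g + B g g = B u g ^+ 2 / B u u + 1 by rewrite /t; field; rewrite Beg gt_eqF.
by rewrite mulrDr mulr1 mulrC divfK ?gt_eqF // => h; lra.
Qed.

(* Both forms are nonpositive on the hyperplane orthogonal to the isotropic
   vectors, hence so is their sum. *)
Lemma hyperbolic_add B1 B2 e1 e2 g : symbil B1 -> symbil B2 ->
  hyperbolic B1 -> hyperbolic B2 ->
  B1 e1 e1 = 0 -> B2 e2 e2 = 0 -> (forall u, B1 e1 u = B2 e2 u) ->
  B1 e1 g != 0 -> hyperbolic (fun u v => B1 u v + B2 u v).
Proof.
move=> b1 b2 h1 h2 e11 e22 e12 e1g.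
have [s1 l1] := b1; have [s2 l2] := b2.
apply: (@hyperbolic_functional _ (B1 e1)).
- by split=> [u v|a u v z]; rewrite ?l1 ?l2 1?s1 1?s2 //; ring.
- by move=> a u v; rewrite s1 l1 !(s1 _ e1).
- move=> u e1u; have le1 := hyperbolic_isotropic b1 h1 e11 e1g e1u.
  have le2 : B2 u u <= 0.
    by apply: (hyperbolic_isotropic b2 h2 e22 (g := g)); rewrite -e12.
  lra.
Qed.

End HyperbolicForms.

(** * An inequality for ultrametric matrices *)

Section Ultrametric.
Variables (F : realFieldType) (T : finType) (X : {set T}).
Implicit Types (K : T -> T -> F) (z : T -> F).

Lemma sqr_sum_le z :
  (\sum_(i in X) z i) ^+ 2 <= #|X|%:R * \sum_(i in X) z i ^+ 2.
Proof.
set s2 := \sum_(i in X) z i ^+ 2.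
have e : \sum_(i in X) \sum_(j in X) (z i ^+ 2 + z j ^+ 2) = #|X|%:R * s2 *+ 2.
  under eq_bigr => i _ do rewrite big_split /= sumr_const -mulr_natl.
  by rewrite big_split /= -mulr_sumr sumr_const -[s2 *+ _]mulr_natl mulr2n.
rewrite -(ler_pMn2r (n := 2)) // -e expr2 mulr_suml -sumrMnl; apply: ler_sum => i _.
rewrite mulr_sumr -sumrMnl; apply: ler_sum => j _.
by rewrite -subr_ge0 addrAC -sqrrB sqr_ge0.
Qed.

(** The double sum is the sum of the squared class sums, so this is Cauchy-Schwarz over the classes,
    of which there are at most [#|X|]. *)
Lemma sqr_sum_le_equiv (E : rel T) z : {in X & &, equivalence_rel E} ->
  (\sum_(i in X) z i) ^+ 2
    <= #|X|%:R * \sum_(i in X) \sum_(j in X) (E i j)%:R * (z i * z j).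
Proof.
(* A canonical representative: [pick] depends only on the values of the predicate, so equivalent
   indices get the same one. *)
move=> eqE; pose rep i := odflt i [pick j in X | E i j].
have Exx i : i \in X -> E i i by move=> iX; have [] := eqE i i i iX iX iX.
have repP i : i \in X -> (rep i \in X) && E i (rep i).
  move=> iX; rewrite /rep; case: pickP => //= /(_ i); by rewrite iX Exx.
have EP i j : i \in X -> j \in X -> E i j = (rep i == rep j).
  move=> iX jX; apply/idP/eqP => [Eij|eqr].
    have eij : (fun y => (y \in X) && E i y) =1 (fun y => (y \in X) && E j y).
      move=> y; have [yX|//] := boolP (y \in X); rewrite /=.
      by have [_ ->] := eqE i j y iX jX yX.
    rewrite /rep (eq_pick eij); case: pickP => //= /(_ j).
    by rewrite jX Exx.
  have /andP[rX Ei] := repP i iX; have /andP[_ Ej] := repP j jX.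
  have [_ h] := eqE j i (rep i) jX iX rX.
  have [_ ->//] := eqE i (rep i) j iX rX jX.
  have [_ h2] := eqE j (rep i) j jX rX jX.
  by rewrite -h2 ?Exx // eqr.
have sumE (f : T -> F) : \sum_(i in X) f i = \sum_(b in X) \sum_(i in X | rep i == b) f i.
  by rewrite (partition_big rep (mem X)) //= => i /repP /andP[].
rewrite sumE; apply: le_trans (sqr_sum_le _) _; rewrite ler_wpM2l ?ler0n //.
rewrite [leRHS]sumE; apply: ler_sum => b _; rewrite expr2 mulr_suml.
apply: ler_sum => i /andP[iX /eqP ri]; rewrite mulr_sumr [leLHS]big_mkcondr /=.
apply: ler_sum => j jX; rewrite EP // ri eq_sym.
by case: eqP => _; rewrite ?mul1r ?mul0r.
Qed.

(* Subtracting the least positive value c from all positive entries keeps K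
   ultrametric, and {K > 0} is an equivalence relation. *)
Lemma ultrametric_sqr_sum_le K (d : F) z :
  {in X, forall i, K i i = d} -> {in X &, forall i j, K i j = K j i} ->
  {in X &, forall i j, 0 <= K i j <= d} ->
  {in X & &, forall i j k, Num.min (K i k) (K j k) <= K i j} ->
  d * (\sum_(i in X) z i) ^+ 2
    <= #|X|%:R * \sum_(i in X) \sum_(j in X) K i j * (z i * z j).
Proof.
pose pos L := [set p : T * T | [&& p.1 \in X, p.2 \in X & 0 < L p.1 p.2 :> F]].
have [N] := ubnP #|pos K|; elim: N K d => // N IH K d; rewrite ltnS => leN Kd Ks Kb Ku.
have [->|[x0 x0X]] := set_0Vmem X.
  by rewrite !big_set0 expr0n /= !mulr0.
have [d0|dpos] := leP d 0.
  have K0 : {in X &, forall i j, K i j = 0}.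
    move=> i j iX jX; apply/eqP; rewrite eq_le.
    by have /andP[-> /le_trans ->] := Kb i j iX jX.
  have -> : \sum_(i in X) \sum_(j in X) K i j * (z i * z j) = 0.
    by apply: big1 => i iX; apply: big1 => j jX; rewrite K0 ?mul0r.
  by rewrite -(Kd x0) // K0 // mul0r mulr0.
have p0 : (x0, x0) \in pos K by rewrite inE /= x0X Kd.
pose c0 := [arg min_(p < (x0, x0) in pos K) K p.1 p.2]%O.
have [c0P cmin] : c0 \in pos K /\
    forall p, p \in pos K -> K c0.1 c0.2 <= K p.1 p.2.
  by rewrite /c0; case: arg_minP.
set c := K c0.1 c0.2 in cmin.
move: (c0P); rewrite inE => /and3P[c1X c2X cpos].
have cle i j : i \in X -> j \in X -> 0 < K i j -> c <= K i j.
  by move=> iX jX Kij; apply: (cmin (i, j)); rewrite inE /= iX jX.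
have cled : c <= d by have /andP[] := Kb _ _ c1X c2X.
pose E i j := 0 < K i j.
pose K' i j := K i j - c * (E i j)%:R.
have K0 i j : i \in X -> j \in X -> ~~ E i j -> K i j = 0.
  move=> iX jX; rewrite -leNgt => le0; apply/eqP; rewrite eq_le le0.
  by case/andP: (Kb i j iX jX).
have K'E i j : i \in X -> j \in X -> K' i j = if E i j then K i j - c else 0.
  move=> iX jX; rewrite /K'; case: ifP => [_|/negbT]; first by rewrite mulr1.
  by move/(K0 i j iX jX) => ->; rewrite mulr0 subrr.
have E_equiv : {in X & &, equivalence_rel E}.
  have sE i j : i \in X -> j \in X -> E i j = E j i by move=> *; rewrite /E Ks.
  have tE i j k : i \in X -> j \in X -> k \in X -> E i k -> E j k -> E i j.
    move=> iX jX kX Eik Ejk; apply: lt_le_trans (Ku i j k iX jX kX).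
    by rewrite lt_min; apply/andP.
  move=> i j k iX jX kX; split; first by rewrite /E Kd.
  move=> Eij; apply/idP/idP => h; rewrite sE //.
    by apply: (tE k j i) => //; rewrite sE.
  by apply: (tE k i j) => //; rewrite sE.
(* The entry at [c0] becomes zero and no new positive entry appears. *)
have ltN : (#|pos K'| < N)%N.
  apply: leq_trans leN; apply: proper_card; apply/properP; split.
    apply/subsetP => -[i j]; rewrite !inE /= => /and3P[iX jX].
    rewrite iX jX K'E //=; by case: ifP; rewrite ?ltxx.
  exists c0 => //; rewrite inE c1X c2X K'E //= /E cpos subrr.
  by rewrite ltxx.
have K'd : {in X, forall i, K' i i = d - c}.
  by move=> i iX; rewrite K'E // /E Kd // dpos.
have K's : {in X &, forall i j, K' i j = K' j i}.
  by move=> i j iX jX; rewrite !K'E // /E Ks.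
have K'b : {in X &, forall i j, 0 <= K' i j <= d - c}.
  move=> i j iX jX; rewrite K'E //; case: ifP => [Eij|_].
    have /andP[_ Kd'] := Kb i j iX jX.
    by rewrite subr_ge0 (cle i j) //= lerD2r.
  by rewrite lexx subr_ge0.
have K'u : {in X & &, forall i j k, Num.min (K' i k) (K' j k) <= K' i j}.
  move=> i j k iX jX kX; rewrite !K'E //; have := Ku i j k iX jX kX.
  rewrite !ge_min; have [Eij|Eij] := boolP (E i j).
    have /(cle i j iX jX) := Eij; rewrite -subr_ge0 => h.
    by case/orP => h'; apply/orP; [left|right]; case: ifP => // _; rewrite lerD2r.
  rewrite (K0 _ _ _ _ Eij) // /E !leNgt.
  by case: (0 < K i k) => /=; [case: (0 < K j k)|]; rewrite ?ltxx ?orbT.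
have le1 := IH K' (d - c) ltN K'd K's K'b K'u.
have le2 := sqr_sum_le_equiv z E_equiv.
have -> : \sum_(i in X) \sum_(j in X) K i j * (z i * z j) =
    \sum_(i in X) \sum_(j in X) K' i j * (z i * z j) +
    c * \sum_(i in X) \sum_(j in X) (E i j)%:R * (z i * z j).
  rewrite mulr_sumr -big_split; apply: eq_bigr => i _ /=.
  rewrite mulr_sumr -big_split; apply: eq_bigr => j _ /=.
  by rewrite [c * (_ * _)]mulrA -mulrDl subrK.
rewrite -[X in X * _ <= _](subrK c) mulrDl mulrDr lerD // [leRHS]mulrCA.
by rewrite ler_wpM2l // ltW.
Qed.

End Ultrametric.

(** * Weights with M-natural-concave logarithm (log 0 = -oo), and their linear and quadratic
    forms *)

Definition Mnat_weight (F : realFieldType) (T : finType) (w : {set T} -> F) :=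
  forall (I1 I2 : {set T}) (i1 : T), i1 \in I1 :\: I2 ->
    w I1 * w I2 <= w (I1 :\ i1) * w (i1 |: I2)
    \/ exists2 i2, i2 \in I2 :\: I1 &
         w I1 * w I2 <= w (i2 |: (I1 :\ i1)) * w (i1 |: (I2 :\ i2)).

Lemma exists_subset_between (T : finType) (S U : {set T}) m :
  S \subset U -> (#|S| <= m <= #|U|)%N ->
  exists S' : {set T}, [/\ S \subset S', S' \subset U & #|S'| = m].
Proof.
move=> SU /andP[]; elim: m => [|m IH]; first by rewrite leqn0 => /eqP S0; exists S.
rewrite leq_eqVlt ltnS => /orP[/eqP eS|lS] lU; first by exists S.
have [S' [SS' S'U cS']] := IH lS (ltnW lU).
have /properP[_ [x xU xS']] : S' \proper U.
  by rewrite properEcard S'U cS'.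
exists (x |: S'); split; first exact: subset_trans SS' (subsetUr _ _).
  by rewrite subUset sub1set xU.
by rewrite cardsU1 xS' cS'.
Qed.

Section LocalForms.
Variables (F : realFieldType) (T : finType) (w : {set T} -> F) (U0 : {set T}).
Implicit Types (u v : option T -> F) (S : {set T}) (r : nat).

(* Let f_S(x, y) be the sum of w(I) x^(I \ S) y^|U0 \ I| over S <= I <= U0, and
   let [u None] be the y-coordinate of u. Up to the factor (r - 1)!, the
   derivative (d/dy)^(r-1) f_S is the linear form [linf r S] if |U0 \ S| = r, and
   is the quadratic form with Hessian [quadf r S] if |U0 \ S| = r + 1. *)
Definition linf r S u : F :=
  r%:R * w S * u None + \sum_(i in U0 :\: S) w (i |: S) * u (Some i).

Definition quadf r S u v : F :=
  r%:R * u None * linf r.+1 S v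
  + \sum_(i in U0 :\: S) u (Some i) * linf r (i |: S) v.

Lemma lin_axpy r S a u v : linf r S (axpy a u v) = a * linf r S u + linf r S v.
Proof.
rewrite /linf /axpy [in RHS]mulrDr mulr_sumr addrACA -big_split /=; congr (_ + _).
  by ring.
by apply: eq_bigr => i _; ring.
Qed.

(** The zero diagonal entries reflect that f_S is affine in each variable x_i. *)
Lemma quadE r S u v : quadf r S u v =
  r%:R * r.+1%:R * w S * (u None * v None) +
  r%:R * (u None * (\sum_(i in U0 :\: S) w (i |: S) * v (Some i)) +
          v None * (\sum_(i in U0 :\: S) w (i |: S) * u (Some i))) +
  \sum_(i in U0 :\: S) \sum_(j in U0 :\: S)
     (if i == j then 0 else w (j |: (i |: S))) * (u (Some i) * v (Some j)).
Proof.
rewrite /quadf /linf.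
under [X in _ + X = _]eq_bigr => i _ do rewrite mulrDr.
rewrite big_split /= !mulrDr !addrA; congr (_ + _); last first.
  apply: eq_bigr => i _; rewrite mulr_sumr [RHS](bigID (pred1 i)) /=.
  rewrite [X in _ = X + _]big1 ?add0r => [|j /andP[_ /eqP->]]; last first.
    by rewrite eqxx mul0r.
  apply: eq_big => [j|j]; first by rewrite !inE; case: (j == i); rewrite ?andbT ?andbF.
  by rewrite !inE negb_or => /andP[/andP[/negPf ji _] _]; rewrite eq_sym ji; ring.
congr (_ + _ + _); [ring|ring|].
by rewrite !mulr_sumr; apply: eq_bigr => i _; ring.
Qed.

Lemma quad_symbil r S : symbil (quadf r S).
Proof.
split=> [u v|a u v z].
  rewrite !quadE; congr (_ + _ + _); [by ring|by ring|].
  rewrite exchange_big; apply: eq_bigr => i _; apply: eq_bigr => j _ /=.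
  by rewrite eq_sym setUCA; congr (_ * _); exact: mulrC.
rewrite /quadf /axpy [in RHS]mulrDr mulr_sumr addrACA -big_split /=; congr (_ + _).
  by ring.
by apply: eq_bigr => i _; ring.
Qed.

Hypotheses (w_gt0 : forall S, 0 < w S) (w_conc : Mnat_weight w).

(** In the exchange of [i] between S + i + j and S there is no candidate for [i2], so the first
    alternative holds. *)
Lemma weight_exchange0 S i j : i \notin S -> j \notin S -> i != j ->
  w (j |: (i |: S)) * w S <= w (i |: S) * w (j |: S).
Proof.
move=> iS jS ij.
have iI : i \in (j |: (i |: S)) :\: S by rewrite !inE iS eqxx orbT.
have e : (j |: (i |: S)) :\ i = j |: S.
  apply/setP => x; rewrite !inE; have [->|_] /= := eqVneq x i.
    by rewrite (negPf ij) (negPf iS).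
  by [].
have [|[i2]] := w_conc iI; first by rewrite e mulrC [leRHS]mulrC mulrC.
by rewrite !inE => /andP[/norP[_ /norP[_ /negPf->]]].
Qed.

(** In the exchange of [i] between S + i + j and S + k the only candidate for [i2] is [k]. *)
Lemma weight_exchange1 S i j k : i \notin S -> j \notin S -> k \notin S ->
  i != j -> i != k -> j != k ->
  w (j |: (i |: S)) * w (k |: S) <= w (k |: (i |: S)) * w (j |: S) \/
  w (j |: (i |: S)) * w (k |: S) <= w (k |: (j |: S)) * w (i |: S).
Proof.
move=> iS jS kS ij ik jk.
have iI : i \in (j |: (i |: S)) :\: (k |: S).
  by rewrite !inE (negPf iS) (negPf ik) eqxx orbT.
have e : (j |: (i |: S)) :\ i = j |: S.
  apply/setP => x; rewrite !inE; have [->|_] /= := eqVneq x i.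
    by rewrite (negPf ij) (negPf iS).
  by [].
have e2 : (k |: S) :\ k = S.
  by rewrite setU1K.
have [|[i2]] := w_conc iI; rewrite e.
  by move=> h; left; rewrite (setUCA [set k] [set i]) [leRHS]mulrC.
rewrite !inE => /andP[/norP[_ /norP[_ /negPf->]]]; rewrite orbF => /eqP->.
by rewrite e2; right.
Qed.

(** On the kernel of [linf r.+1 S], the y-derivative up to a factor, [u None] is determined by the
    other coordinates, and nonpositivity becomes the ultrametric inequality for [K]. *)
Lemma quad_hyperbolic r S : #|U0 :\: S| = r.+1 -> hyperbolic (quadf r S).
Proof.
move=> cS; apply: (hyperbolic_functional (l := linf r.+1 S)).
- exact: quad_symbil.
- exact: lin_axpy.
move=> u lu0; set X := U0 :\: S in cS *.
(* As [w] is positive, the two exchange inequalities give entries in [0, 1] and ultrametricity. *)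
pose K i j : F := if i == j then 1 else
  1 - w S * w (j |: (i |: S)) / (w (i |: S) * w (j |: S)).
have notS i : i \in X -> i \notin S by rewrite inE => /andP[].
have Ks : {in X &, forall i j, K i j = K j i}.
  move=> i j _ _; rewrite /K eq_sym; case: eqP => // _.
  by rewrite setUCA [w (j |: S) * _]mulrC.
have Kb : {in X &, forall i j, 0 <= K i j <= 1}.
  move=> i j /notS iS /notS jS; rewrite /K; case: eqVneq => [_|ij].
    by rewrite ler01 lexx.
  rewrite subr_ge0 ler_pdivrMr ?mulr_gt0 // mul1r [w S * _]mulrC.
  rewrite weight_exchange0 //= gerBl divr_ge0 ?mulr_ge0 ?ltW //.
have Ku : {in X & &, forall i j k, Num.min (K i k) (K j k) <= K i j}.
  move=> i j k iX jX kX; rewrite ge_min.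
  have [ij|ij] := eqVneq i j; first by case/andP: (Kb i k iX kX) => _; rewrite {3}/K ij eqxx => ->.
  have [ik|ik] := eqVneq i k; first by rewrite -ik (Ks j i) // lexx orbT.
  have [jk|jk] := eqVneq j k; first by rewrite -jk lexx.
  have [[iS jS] kS] := (notS i iX, notS j jX, notS k kX).
  rewrite /K (negPf ij) (negPf ik) (negPf jk) !lerD2l !lerN2.
  rewrite !ler_pdivlMr ?mulr_gt0 //.
  case: (weight_exchange1 iS jS kS ij ik jk) => h; apply/orP; [left|right].
    rewrite mulrAC ler_pdivrMr ?mulr_gt0 //.
    have := ler_wpM2l (ltW (mulr_gt0 (w_gt0 S) (w_gt0 (i |: S)))) h; lra.
  rewrite mulrAC ler_pdivrMr ?mulr_gt0 //.
  have := ler_wpM2l (ltW (mulr_gt0 (w_gt0 S) (w_gt0 (j |: S)))) h; lra.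
have Kd : {in X, forall i, K i i = 1} by move=> i _; rewrite /K eqxx.
pose z i := w (i |: S) * u (Some i).
have := ultrametric_sqr_sum_le z Kd Ks Kb Ku.
set s := \sum_(i in X) z i; rewrite mul1r cS.
pose P := \sum_(i in X) \sum_(j in X)
   (if i == j then 0 else w (j |: (i |: S))) * (u (Some i) * u (Some j)).
have -> : \sum_(i in X) \sum_(j in X) K i j * (z i * z j) = s ^+ 2 - w S * P.
  rewrite expr2 mulr_suml mulr_sumr -sumrB; apply: eq_bigr => i _.
  rewrite !mulr_sumr -sumrB; apply: eq_bigr => j _.
  rewrite /K; case: eqP => [_|_]; first by rewrite mul1r mul0r mulr0 subr0.
  rewrite /z; field.
  by rewrite !gt_eqF.
move: lu0; rewrite quadE -/P /linf -/X -/s => lu0 le.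
have w0 := w_gt0 S.
have c0 : 0 < r.+1%:R * w S by rewrite mulr_gt0 // ltr0n.
(* After this scaling and elimination of [u None], the claim is (r + 1) [w S * P] <= r [s ^+ 2], a
   rearrangement of [le]. *)
rewrite -(pmulr_rle0 _ c0).
move: lu0 le.
set q : F := r.+1%:R; set N := u None => lu0 le.
have es : s = - (q * w S * N) by lra.
have eq : r%:R = q - 1 :> F by rewrite /q -natr1 addrK.
rewrite eq.
have -> : q * w S * ((q - 1) * q * w S * (N * N) + (q - 1) * (N * s + N * s) + P)
   = - (q - 1) * s ^+ 2 + q * w S * P by rewrite es; ring.
lra.
Qed.

End LocalForms.

(** * Mixed derivatives of two copies of the generating polynomial *)

Section MixedForm.
Variables (F : realFieldType) (T : finType) (w : {set T} -> F).
Variables (A U0 : {set T}) (p r : nat).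
Implicit Types (u v : bool * option T -> F) (S U : {set T}).

(** For [S] between [A] and [U0] this is its complement in that interval: the two sets meet in [A]
    and have union [U0]. *)
Definition reflect_set S := A :|: (U0 :\: S).
Local Notation co := reflect_set.
Local Notation lin := (linf w U0 r).
Local Notation quad := (quadf w U0 r).

Definition part (b : bool) u : option T -> F := fun o => u (b, o).

(* Hessian (up to a factor) of
   (d/dy)^(r-1) (d/dz)^(r-1) d_x^(S \ A) d_x'^(U0 \ S) f_A(x, y) f_A(x', z);
   the coordinates tagged [true] are (x, y), those tagged [false] are (x', z). *)
Definition leaf S u v : F :=
  if #|S| == p then w (co S) * quad S (part true u) (part true v)
  else if #|S| == p.+1 then
    lin S (part true u) * lin (co S) (part false v)
    + lin S (part true v) * lin (co S) (part false u)
  else if #|S| == p.+2 then w S * quad (co S) (part false u) (part false v)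
  else 0.

(* For i in U \ S1, the derivative with respect to x_i or x'_i is replaced by
   the sum of both. *)
Definition mixed S1 U u v : F :=
  \sum_(S : {set T} | (S1 \subset S) && (S \subset U)) leaf S u v.

Definition unitv (b : bool) (o : option T) : bool * option T -> F :=
  fun x => (x == (b, o))%:R.

Lemma leaf_symbil S : symbil (leaf S).
Proof.
rewrite /leaf; have [q1 q2] := (quad_symbil w U0 r S, quad_symbil w U0 r (co S)).
case: q1 q2 => [s1 l1] [s2 l2]; split=> [u v|a u v z].
  by rewrite s1 s2; do !case: ifP => _ //; ring.
case: ifP => _; first by rewrite (l1 a (part true u)); ring.
case: ifP => _.
  by rewrite (lin_axpy _ _ _ _ a (part true u)) (lin_axpy _ _ _ _ a (part false u)); ring.
case: ifP => _; first by rewrite (l2 a (part false u)); ring.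
by rewrite mulr0 addr0.
Qed.

Lemma mixed_symbil S1 U : symbil (mixed S1 U).
Proof.
split=> [u v|a u v z]; rewrite /mixed.
  by apply: eq_bigr => S _; have [-> _] := leaf_symbil S.
by rewrite mulr_sumr -big_split; apply: eq_bigr => S _; have [_ ->] := leaf_symbil S.
Qed.

Lemma mixed_split S1 U i : i \in U :\: S1 ->
  mixed S1 U =2 fun u v => mixed (i |: S1) U u v + mixed S1 (U :\ i) u v.
Proof.
rewrite inE => /andP[iS1 iU] u v; rewrite /mixed (bigID (fun S => i \in S)) /=.
congr (_ + _); apply: eq_bigl => S.
  by rewrite subUset sub1set andbC andbA.
by rewrite subsetD1 andbA.
Qed.

Lemma lin_unitv S b b' o : lin S (part b (unitv b' o)) =
  if b == b' then
    if o is Some i then (i \in U0 :\: S)%:R * w (i |: S) else r%:R * w S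
  else 0.
Proof.
rewrite /linf /part /unitv /= !xpair_eqE.
under eq_bigr => j _ do rewrite xpair_eqE.
case: eqP => _ /=; last first.
  by rewrite mulr0 add0r big1 // => j _; rewrite mulr0.
case: o => [i|]; last first.
  by rewrite mulr1 big1 ?addr0 // => j _; rewrite mulr0.
rewrite mulr0 add0r; have [iS|iS] := boolP (i \in _).
  rewrite (bigD1 i) //= eqxx mulr1 mul1r big1 ?addr0 // => j /andP[_ ji].
  by rewrite (_ : _ == _ = false) ?mulr0 //; apply/negbTE; apply: contraNneq ji => -[->].
rewrite mul0r big1 // => j jS; rewrite (_ : _ == _ = false) ?mulr0 //.
by apply/negbTE; apply: contraNneq iS => -[<-].
Qed.

Lemma quad_unitv_Some S b b' i y : quad S (part b (unitv b' (Some i))) y =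
  if (b == b') && (i \in U0 :\: S) then lin (i |: S) y else 0.
Proof.
rewrite /quadf /part /unitv /= xpair_eqE andbF mulr0 mul0r add0r.
under eq_bigr => j _ do rewrite xpair_eqE.
case: eqP => _ /=; last by rewrite big1 // => j _; rewrite mul0r.
have [iS|iS] := boolP (i \in _).
  rewrite (bigD1 i) //= eqxx mul1r big1 ?addr0 // => j /andP[_ ji].
  by rewrite (_ : _ == _ = false) ?mul0r //; apply/negbTE; apply: contraNneq ji => -[->].
rewrite big1 // => j jS; rewrite (_ : _ == _ = false) ?mul0r //.
by apply/negbTE; apply: contraNneq iS => -[<-].
Qed.

Lemma quad_unitv_None S b : quad S (part b (unitv b None)) (part b (unitv b None))
  = r%:R * r.+1%:R * w S.
Proof.
rewrite quadE /part /unitv eqxx !mulr1 mul1r.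
have e i : ((b, Some i) == (b, None :> option T)) = false.
  by apply/negbTE; apply/eqP => -[].
rewrite big1 => [|j _]; last by rewrite e mulr0.
rewrite addr0 mulr0 addr0 big1 ?addr0 // => i _.
by rewrite big1 // => j _; rewrite !e !mulr0.
Qed.

Lemma card_reflect S : A \subset S -> S \subset U0 ->
  (#|S| + #|co S| = #|A| + #|U0|)%N.
Proof.
move=> AS SU; rewrite cardsU cardsD (setIidPr SU).
have -> : A :&: (U0 :\: S) = set0.
  by apply/eqP; rewrite setI_eq0 disjoints_subset; apply: subset_trans AS _;
     rewrite setDE setCI setCK subsetUr.
rewrite cards0; have := subset_leq_card SU; lia.
Qed.

Hypotheses (subA : A \subset U0) (r_gt0 : (0 < r)%N).
Hypotheses (cardU0 : #|U0| = (r + p.+1)%N) (cardA : (#|A| + r = p.+1)%N).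

Lemma in_reflect S i : i \in U0 :\: A -> (i \in co S) = (i \notin S).
Proof. by rewrite !inE => /andP[/negPf-> ->]; rewrite andbT. Qed.

Lemma reflectK S : A \subset S -> S \subset U0 -> co (co S) = S.
Proof.
move=> /subsetP AS /subsetP SU; apply/setP => x; rewrite !inE.
have := AS x; have := SU x; have := subsetP subA x.
by case: (x \in A); case: (x \in U0); case: (x \in S) => //= h1 h2 h3;
  first [by move: (h1 isT) | by move: (h2 isT) | by move: (h3 isT)].
Qed.

Lemma reflect_sub S : (A \subset co S) && (co S \subset U0).
Proof. by rewrite subsetUl subUset subA subsetDl. Qed.

Lemma reflectU1 S i : i \in S -> i \in U0 :\: A -> co (S :\ i) = i |: co S.
Proof.
rewrite inE => iS /andP[_ iU]; apply/setP => x; rewrite !inE.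
by have [->|_] := eqVneq x i; rewrite /= ?iU ?orbT.
Qed.

(** Both sides are the same derivative: [leaf S] is already differentiated in x_i and
    [leaf (S :\ i)] in x'_i, and each side applies the missing one. *)
Lemma leaf_unitv_reflect S i u : i \in S -> i \in U0 :\: A ->
  leaf S (unitv false (Some i)) u = leaf (S :\ i) (unitv true (Some i)) u.
Proof.
move=> iS iUA; have iU : i \in U0 by move: iUA; rewrite inE => /andP[].
rewrite /leaf !quad_unitv_Some !lin_unitv (reflectU1 iS iUA) /=.
rewrite (cardsD1 i S) iS add1n !eqSS [i \in _ :\: co S]inE (in_reflect _ iUA) iS.
rewrite [i \in _ :\: (_ :\ _)]inE setD11 iU /= setD1K // !mulr0 !mul0r !mul1r.
case: (eqVneq #|S :\ i| p) => [->|_].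
  by rewrite (gtn_eqF (ltnSn p)) add0r mulrC.
case: (eqVneq #|S :\ i| p.+1) => [->|_]; first by rewrite gtn_eqF ?addr0 // ltnW.
by rewrite !if_same.
Qed.

Lemma mixed_unitv_reflect S1 U i u : i \in U :\: S1 -> i \in U0 :\: A ->
  mixed (i |: S1) U (unitv false (Some i)) u
  = mixed S1 (U :\ i) (unitv true (Some i)) u.
Proof.
move=> /setDP[iU iS1] iUA; rewrite /mixed.
rewrite (reindex_onto (fun S => i |: S) (fun S => S :\ i)) /=; last first.
  by move=> S /andP[]; rewrite subUset sub1set => /andP[iS _] _; rewrite setD1K.
apply: eq_big => [S|S /andP[_ /eqP e]]; last first.
  by rewrite (leaf_unitv_reflect _ (setU11 i S) iUA) e.
apply/idP/idP.
  case/andP=> /andP[h1 h2] /eqP e; have iS : i \notin S by rewrite -e setD11.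
  rewrite subsetD1 iS andbT (subset_trans (subsetUr _ _) h2) andbT.
  by move/(setSD [set i]): h1; rewrite !setU1K.
case/andP=> h1; rewrite subsetD1 => /andP[h2 iS].
by rewrite setUS // subUset sub1set iU h2 setU1K ?eqxx.
Qed.

Hypotheses (w_gt0 : forall S, 0 < w S) (w_conc : Mnat_weight w).

Lemma leaf_hyperbolic S : A \subset S -> S \subset U0 -> hyperbolic (leaf S).
Proof.
move=> AS SU; have cc := card_reflect AS SU.
have scale c B b : 0 < c -> @hyperbolic F (option T) B ->
    hyperbolic (fun u v => c * B (part b u) (part b v)).
  move=> c0 hB u v; rewrite pmulr_rgt0 // => Bu; have h := hB _ (part b v) Bu.
  by rewrite mulrACA exprMn -expr2 ler_pM2l // exprn_gt0.
rewrite /leaf => u v.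
case: eqP => [eS|_].
  apply: (scale _ _ true (w_gt0 _)).
  by apply: quad_hyperbolic => //; rewrite cardsD (setIidPr SU) cardU0 eS; lia.
case: eqP => [eS|_].
  (* A product of two linear forms vanishes on the kernel of either. *)
  move: u v; apply: (hyperbolic_functional (l := fun u => lin S (part true u))).
  - split=> [u v|a u v z]; first by ring.
    by rewrite (lin_axpy _ _ _ _ a (part true u)) (lin_axpy _ _ _ _ a (part false u)); ring.
  - by move=> a u v; rewrite -lin_axpy.
  - by move=> u ->; rewrite !mul0r addr0.
case: eqP => [eS|_]; last by rewrite ltxx.
apply: (scale _ _ false (w_gt0 _)).
apply: quad_hyperbolic => //; have /andP[_ cU] := reflect_sub S.
by rewrite cardsD (setIidPr cU) cardU0; lia.
Qed.

(** The direction y + z, used to test nondegeneracy. *)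
Let g : bool * option T -> F := fun x => (x.2 == None)%:R.

Lemma lin_g S b : lin S (part b g) = r%:R * w S.
Proof.
by rewrite /linf /part /g /= mulr1 big1 ?addr0 // => i _; rewrite mulr0.
Qed.

(** All terms are nonnegative, and those with [S] of size p + 1 or p + 2 are positive; the
    cardinality bounds ensure that such an [S] exists. *)
Lemma mixed_nondegenerate S1 U i : A \subset S1 -> S1 \subset U ->
  U \subset U0 -> i \in U :\: S1 -> (#|S1| <= p.+1)%N -> (p < #|U|)%N ->
  mixed (i |: S1) U (unitv false (Some i)) g != 0.
Proof.
move=> AS SU UU iUS c1 c2; have iUA : i \in U0 :\: A.
  move: iUS; rewrite !inE => /andP[h /(subsetP UU) ->]; rewrite andbT.
  by apply: contra h => /(subsetP AS).
have [iS1 iU] : i \notin S1 /\ i \in U by move: iUS; rewrite inE => /andP[].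
have iU0 := subsetP UU i iU.
have rR : 0 < r%:R :> F by rewrite ltr0n.
have leafE S : i \in S -> leaf S (unitv false (Some i)) g =
    if (#|S| == p.+1) || (#|S| == p.+2) then r%:R * w S * w (i |: co S) else 0.
  move=> iS; rewrite /leaf !quad_unitv_Some !lin_unitv !lin_g /=.
  rewrite inE in_reflect // iS /= iU0 mulr0 mul0r mul1r add0r.
  case: (eqVneq #|S| p) => [->|_]; first by rewrite !ltn_eqF //; lia.
  by case: eqP => //= _; case: eqP => //= _; ring.
have leaf_ge0 S : i \in S -> 0 <= leaf S (unitv false (Some i)) g.
  move=> iS; rewrite leafE //; case: ifP => // _.
  by rewrite !mulr_ge0 ?ler0n // ltW.
have c3 : (#|S1|.+1 <= #|U|)%N.
  by rewrite -add1n -[1%N]/(nat_of_bool true) -iS1 -cardsU1 subset_leq_card // subUset sub1set iU.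
(* The size is p + 1, or p + 2 when [S1] already has p + 1 elements. *)
have [||S [h1 h2 h3]] := @exists_subset_between T (i |: S1) U (maxn p.+1 #|S1|.+1).
- by rewrite subUset sub1set iU.
- by rewrite cardsU1 iS1 leq_maxr geq_max c2.
have iS : i \in S by apply: (subsetP h1); rewrite setU11.
rewrite /mixed (bigD1 S) ?h1 //= gt_eqF // ltr_pwDl //.
  rewrite leafE // h3 ifT ?mulr_gt0 //.
  move: c1; rewrite leq_eqVlt => /orP[/eqP->|c1].
    by rewrite (maxn_idPr (leqnSn _)) eqxx orbT.
  by rewrite (maxn_idPl c1) eqxx.
apply: sumr_ge0 => S' /andP[/andP[h _] _]; apply: leaf_ge0.
by apply: (subsetP h); rewrite setU11.
Qed.

Lemma mixed_hyperbolic S1 U : A \subset S1 -> S1 \subset U -> U \subset U0 ->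
  hyperbolic (mixed S1 U).
Proof.
have [N] := ubnP #|U :\: S1|; elim: N S1 U => // N IH S1 U.
rewrite ltnS => leN AS SU UU.
have ext B B' : B =2 B' -> @hyperbolic F (bool * option T) B' -> hyperbolic B.
  by move=> e h u v; rewrite !e; apply: h.
have [US|[i iUS]] := set_0Vmem (U :\: S1).
  have eU : U = S1 by apply/eqP; rewrite eqEsubset SU -setD_eq0 US eqxx.
  apply: (ext _ (leaf S1)); last by apply: leaf_hyperbolic; rewrite // -eU.
  move=> u v; rewrite /mixed eU (big_pred1 S1) // => S.
  by rewrite /= -eqEsubset eq_sym.
have [iS1 iU] : i \notin S1 /\ i \in U by move: iUS; rewrite inE => /andP[].
have iUA : i \in U0 :\: A.
  rewrite inE (subsetP UU) // andbT; by apply: contra iS1 => /(subsetP AS).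
have h1 : hyperbolic (mixed (i |: S1) U).
  apply: IH => //.
  - by apply: leq_trans leN; rewrite setUC -setDDl [X in (_ < X)%N](cardsD1 i) iUS.
  - exact: subset_trans AS (subsetUr _ _).
  - by rewrite subUset sub1set iU.
have h2 : hyperbolic (mixed S1 (U :\ i)).
  apply: IH => //.
  - apply: leq_trans leN; rewrite [X in (_ < X)%N](cardsD1 i) iUS.
    by rewrite setDDl setUC -setDDl.
  - by rewrite subsetD1 SU.
  - exact: subset_trans (subsetDl _ _) UU.
apply: (ext _ _ (mixed_split iUS)).
(* If [S1] has more than p + 1 elements, every leaf of the first summand has size above p + 2 and
   vanishes. *)
have [c1|c1] := leqP #|S1| p.+1; last first.
  apply: (ext _ _ _ h2) => u v; rewrite [X in X + _]big1 ?add0r // => S /andP[hS _].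
  have := subset_leq_card hS; rewrite cardsU1 iS1 add1n => cS.
  have ltS := leq_ltn_trans c1 cS.
  by rewrite /leaf !gtn_eqF // ltnW // ltnW.
(* If [U] has at most p elements, every leaf of the second summand has size below p and vanishes. *)
have [c2|c2] := leqP #|U| p.
  apply: (ext _ _ _ h1) => u v; rewrite [X in _ + X]big1 ?addr0 // => S /andP[_ hS].
  have := subset_leq_card hS; have := cardsD1 i U; rewrite iU add1n => e cS.
  have ltS : (#|S| < p)%N by apply: leq_trans c2; rewrite e ltnS.
  by rewrite /leaf !ltn_eqF // !leqW.
(* The two vectors are isotropic because no second derivative in a single x_i or x'_i survives. *)
apply: (hyperbolic_add (e1 := unitv false (Some i)) (e2 := unitv true (Some i)) (g := g)) => //.
- exact: mixed_symbil.
- exact: mixed_symbil.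
- rewrite /mixed big1 // => S /andP[hS _]; have iS : i \in S.
    by apply: (subsetP hS); rewrite setU11.
  rewrite /leaf !quad_unitv_Some !lin_unitv /= !mulr0 !mul0r addr0.
  by rewrite [i \in _ :\: (i |: _)]inE setU11 /= ?mul0r ?mulr0 !if_same ?mulr0 !if_same.
- rewrite /mixed big1 // => S /andP[_ hS]; have iS : i \notin S.
    by move: hS; rewrite subsetD1 => /andP[].
  rewrite /leaf !quad_unitv_Some !lin_unitv /= !mulr0 addr0.
  by rewrite [i \in _ :\: (i |: _)]inE setU11 /= ?mul0r ?mulr0 !if_same ?mulr0 !if_same.
- by move=> u; apply: mixed_unitv_reflect.
- exact: mixed_nondegenerate.
Qed.

(** With a and b the two sums, the y, z block of the form has diagonal entries r(r + 1)a and
    off-diagonal entry r^2 b; the reverse Cauchy-Schwarz inequality compares their squares. *)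
Lemma reflect_sum_le_pos :
  r.+1%:R * \sum_(S : {set T} | [&& A \subset S, S \subset U0 & #|S| == p]) w S * w (co S)
  <= r%:R * \sum_(S : {set T} | [&& A \subset S, S \subset U0 & #|S| == p.+1]) w S * w (co S).
Proof.
set a := \sum_(S | _) _; set b := \sum_(S | [&& _, _ & _ == p.+1]) _.
have rR : 0 < r%:R :> F by rewrite ltr0n.
have a0 : 0 <= a by apply: sumr_ge0 => S _; rewrite mulr_ge0 // ltW.
have b0 : 0 <= b by apply: sumr_ge0 => S _; rewrite mulr_ge0 // ltW.
have bigE q (f : {set T} -> F) (G : {set T} -> F) :
    (forall S, A \subset S -> S \subset U0 -> f S = if #|S| == q then G S else 0) ->
    \sum_(S : {set T} | (A \subset S) && (S \subset U0)) f S =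
    \sum_(S : {set T} | [&& A \subset S, S \subset U0 & #|S| == q]) G S.
  move=> FG; under [RHS]eq_bigl => S do rewrite andbA.
  by rewrite [RHS]big_mkcondr; apply: eq_bigr => S /andP[? ?]; exact: FG.
have q0 S d y : quad S (part d (unitv (~~ d) None)) y = 0.
  have z o : part d (unitv (~~ d) None) o = 0.
    by rewrite /part /unitv xpair_eqE; case: d.
  rewrite /quadf z mulr0 mul0r add0r big1 // => i _.
  by rewrite z mul0r.
have q0' S d y : quad S y (part d (unitv (~~ d) None)) = 0.
  by have [-> _] := quad_symbil w U0 r S; exact: q0.
pose g1 := unitv true None; pose g2 := unitv false None.
pose c : F := r%:R * r.+1%:R.
have c0 : 0 < c by rewrite mulr_gt0 // ltr0n.
have e11 : mixed A U0 g1 g1 = c * a.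
  rewrite mulr_sumr; apply: bigE => S _ _; rewrite /leaf /g1 !(q0 _ false) !lin_unitv /=.
  by rewrite quad_unitv_None mulr0 mulr0 addr0 !if_same; case: ifP => // _; rewrite /c; ring.
have e12 : mixed A U0 g1 g2 = r%:R ^+ 2 * b.
  rewrite mulr_sumr; apply: bigE => S _ _.
  rewrite /leaf /g1 /g2 (q0 _ false) (q0' _ true) !lin_unitv /= !mulr0 addr0.
  case: (eqVneq _ p) => [->|_]; first by rewrite ltn_eqF.
  by rewrite if_same; case: ifP => // _; ring.
(* This entry runs over sets of size p + 2, which [co] carries to sets of size p. *)
have e22 : mixed A U0 g2 g2 = c * a.
  transitivity (\sum_(S : {set T} | [&& A \subset S, S \subset U0 & #|S| == p.+2])
      c * (w S * w (co S))).
    apply: bigE => S _ _; rewrite /leaf /g2 !(q0 _ true) !lin_unitv /=.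
    rewrite quad_unitv_None !mulr0 !mul0r addr0.
    case: (eqVneq _ p) => [->|_]; first by rewrite ltn_eqF // leqW.
    case: (eqVneq _ p.+1) => [->|_]; first by rewrite ltn_eqF.
    by case: ifP => // _; rewrite /c; ring.
  rewrite -mulr_sumr; congr (_ * _); rewrite /a (reindex_onto co co) /=; last first.
    by move=> S /and3P[AS SU _]; apply: reflectK.
  apply: eq_big => [S|S /andP[_ /eqP->]]; last exact: mulrC.
  have /andP[-> ->] := reflect_sub S; rewrite /=; apply/andP/and3P.
    case=> /eqP cS /eqP e; have /andP[AS SU] := reflect_sub (co S).
    rewrite e in AS SU; have := card_reflect AS SU; rewrite AS SU; split=> //; lia.
  case=> AS SU /eqP cS; have := card_reflect AS SU; rewrite reflectK // eqxx; lia.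
have [a_le0|a_gt0] := leP a 0.
  by rewrite (_ : a = 0) ?mulr0 ?mulr_ge0 ?ler0n //; apply/eqP; rewrite eq_le a_le0.
have := @mixed_hyperbolic A U0 (subxx _) subA (subxx _) g1 g2.
rewrite e11 e12 e22 => /(_ (mulr_gt0 c0 a_gt0)).
rewrite -expr2 ler_sqr ?nnegrE ?(mulr_ge0 (ltW c0)) ?mulr_ge0 ?exprn_ge0 ?ler0n //.
by rewrite /c expr2 -!mulrA ler_pM2l.
Qed.

End MixedForm.

(** * Perturbation to positive weights *)

Section Perturbation.
Variables (F : realFieldType) (T : finType).
Implicit Types (w : {set T} -> F) (S : {set T}) (eps : F) (e : T).

Definition flip e S : {set T} := [set x | (x \in S) (+) (x == e)].

(* Supremal convolution with the concave weight on {0, 1} that penalizes a change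
   of e by the factor eps. *)
Definition perturb eps e w S : F := Num.max (w S) (eps * w (flip e S)).

Lemma flipK e S : flip e (flip e S) = S.
Proof. by apply/setP => x; rewrite !inE addbK. Qed.

Lemma flipD1 e S i : i != e -> flip e S :\ i = flip e (S :\ i).
Proof.
move=> ie; apply/setP => x; rewrite !inE.
by have [->|_] := eqVneq x i; rewrite /= ?(negPf ie).
Qed.

Lemma flipU1 e S i : i != e -> i |: flip e S = flip e (i |: S).
Proof.
move=> ie; apply/setP => x; rewrite !inE.
by have [->|_] := eqVneq x i; rewrite /= ?(negPf ie).
Qed.

Lemma flip_notin e S : e \notin S -> flip e S = e |: S.
Proof.
move=> eS; apply/setP => x; rewrite !inE.
by have [->|_] := eqVneq x e; rewrite ?addbF // (negPf eS).
Qed.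

Lemma flip_in e S : e \in S -> flip e S = S :\ e.
Proof.
move=> eS; apply/setP => x; rewrite !inE.
by have [->|_] := eqVneq x e; rewrite ?addbF // eS.
Qed.

(** Each perturbed value comes from the set or from its flip; the exchange for these sets is carried
    back, and [eps <= 1] absorbs spare penalties. *)
Lemma Mnat_perturb eps e w : 0 <= eps <= 1 -> (forall S, 0 <= w S) ->
  Mnat_weight w -> Mnat_weight (perturb eps e w).
Proof.
move=> /andP[eps0 eps1] w0 Mw; pose w' := perturb eps e w; rewrite -/w'.
have w'1 S : w S <= w' S by rewrite le_max lexx.
have w'2 S : eps * w (flip e S) <= w' S by rewrite le_max lexx orbT.
have w'3 S : eps * w S <= w' (flip e S) by rewrite -{1}(flipK e S).
have epsw S : 0 <= eps * w S by rewrite mulr_ge0.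
have w'P S : w' S = w S \/ w' S = eps * w (flip e S).
  by rewrite /w' /perturb maxEle; case: ifP; [right|left].
have eps2 a b c d : 0 <= a -> 0 <= b -> a <= c -> b <= d ->
    (eps * a) * (eps * b) <= c * d.
  move=> a0 b0 ac bd; apply: ler_pM; rewrite ?mulr_ge0 //.
    by apply: le_trans ac; rewrite ler_piMl.
  by apply: le_trans bd; rewrite ler_piMl.
(* If [i = e], removing it from [I1] and adding it to [I2] are flips, so the exchange for [w] is
   needed only when neither value comes from a flip. *)
move=> I1 I2 i; have [->|ie] := eqVneq i e.
  move=> eI; move: (eI); rewrite inE => /andP[e2 e1].
  have f1 := flip_in e1; have f2 := flip_notin e2.
  have g1 : eps * w I1 <= w' (I1 :\ e) by rewrite -f1.
  have g2 : eps * w I2 <= w' (e |: I2) by rewrite -f2.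
  case: (w'P I1) (w'P I2) => -> [] ->.
  - have [h|[j jI h]] := Mw _ _ _ eI; [left|right; exists j => //];
    by apply: le_trans h _; apply: ler_pM.
  - by left; rewrite mulrCA mulrA f2; apply: ler_pM.
  - by left; rewrite f1 [eps * _]mulrC -mulrA; apply: ler_pM.
  - by left; rewrite f1 f2; apply: eps2.
rewrite inE => /andP[i2 i1].
(* [b1] and [b2] record which of the two values come from a flip. *)
have lift (b1 b2 : bool) : let J1 := if b1 then flip e I1 else I1 in
    let J2 := if b2 then flip e I2 else I2 in
    let a1 := if b1 then eps else 1 in let a2 := if b2 then eps else 1 in
    w' (I1 :\ i) * w' (i |: I2) >= a1 * w J1 * (a2 * w J2) \/
    exists2 j, j \in I2 :\: I1 &
      w' (j |: (I1 :\ i)) * w' (i |: (I2 :\ j)) >= a1 * w J1 * (a2 * w J2).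
  move=> J1 J2 a1 a2.
  have a10 : 0 <= a1 by rewrite /a1; case: (b1).
  have a20 : 0 <= a2 by rewrite /a2; case: (b2).
  have aw (b : bool) S : (if b then eps else 1) * w (if b then flip e S else S) <= w' S.
    by case: b => //; rewrite mul1r.
  have iJ : i \in J1 :\: J2.
    by rewrite inE /J1 /J2; case: (b1) (b2) => [] [];
       rewrite ?inE ?(negPf ie) ?addbF i1 i2.
  have J1D : J1 :\ i = if b1 then flip e (I1 :\ i) else I1 :\ i.
    by rewrite /J1; case: (b1); rewrite ?flipD1.
  have J2U : i |: J2 = if b2 then flip e (i |: I2) else i |: I2.
    by rewrite /J2; case: (b2); rewrite ?flipU1.
  have [h|[j jJ h]] := Mw _ _ _ iJ.
    left; rewrite mulrACA; apply: (@le_trans _ _ (a1 * a2 * (w (J1 :\ i) * w (i |: J2)))).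
      by rewrite ler_wpM2l // mulr_ge0.
    by rewrite mulrACA J1D J2U; apply: ler_pM; rewrite ?aw ?mulr_ge0.
  have {h} h : a1 * w J1 * (a2 * w J2) <= a1 * a2 * (w (j |: (J1 :\ i)) * w (i |: (J2 :\ j))).
    by rewrite mulrACA ler_wpM2l // mulr_ge0.
  have [je|je] := eqVneq j e; last first.
    right; exists j.
      by move: jJ; rewrite !inE /J1 /J2; case: (b1) (b2) => [] [];
         rewrite ?inE ?(negPf je) ?addbF.
    apply: le_trans h _; rewrite mulrACA J1D.
    have -> : j |: (if b1 then flip e (I1 :\ i) else I1 :\ i)
        = if b1 then flip e (j |: (I1 :\ i)) else j |: (I1 :\ i).
      by case: (b1); rewrite ?flipU1.
    have -> : i |: J2 :\ j = if b2 then flip e (i |: (I2 :\ j)) else i |: (I2 :\ j).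
      by rewrite /J2; case: (b2); rewrite ?flipD1 ?flipU1.
    by apply: ler_pM; rewrite ?aw ?mulr_ge0.
  (* Here [j = e]. Unless neither set was flipped, moving [e] toggles both flips, which gives the
     first alternative with no more penalties than before. *)
  have fI1 : e \in I1 -> e |: flip e (I1 :\ i) = I1 :\ i.
    by move=> eI; rewrite flip_in ?setD1K // !inE eq_sym ie.
  have fI2 : e \notin I2 -> flip e I2 :\ e = I2.
    by move=> eI; rewrite flip_notin // setU1K.
  rewrite {j}je in jJ h.
  move: jJ h; rewrite /a1 /a2 J1D /J1 /J2 inE; case: (b1) (b2) => [] [] /=;
    rewrite ?inE ?eqxx ?addbT ?negbK => /andP[e1 e2].
  - rewrite (fI1 e1) (fI2 e2) => h; left; apply: le_trans h _.
    by rewrite mulrACA; apply: eps2.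
  - rewrite (fI1 e1) => h; left; apply: le_trans h _; rewrite mulr1 mulrCA.
    by apply: ler_pM; rewrite // -(flip_in e2) flipU1.
  - rewrite (fI2 e2) => h; left; apply: le_trans h _; rewrite mul1r mulrA.
    by apply: ler_pM; rewrite // -flip_notin // !inE negb_and e1 orbT.
  - move=> h; right; exists e; first by rewrite inE e1.
    by apply: le_trans h _; rewrite !mul1r; apply: ler_pM.
have := lift (w' I1 != w I1) (w' I2 != w I2).
have E S : w' S = (if w' S != w S then eps else 1) * w (if w' S != w S then flip e S else S).
  by case: eqVneq => [->|/eqP]; rewrite ?mul1r //; case: (w'P S).
by rewrite /= -!E.
Qed.

Definition perturb_seq eps (s : seq T) w : {set T} -> F :=
  foldr (perturb eps) w s.

Lemma perturb_seq_ge eps s w S : w S <= perturb_seq eps s w S.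
Proof. by elim: s => //= e s IH; apply: le_trans IH _; rewrite le_max lexx. Qed.

Lemma Mnat_perturb_seq eps s w : 0 <= eps <= 1 -> (forall S, 0 <= w S) ->
  Mnat_weight w -> Mnat_weight (perturb_seq eps s w).
Proof.
move=> he w0 Mw; elim: s => //= e s IH; apply: Mnat_perturb => // S.
exact: le_trans (perturb_seq_ge _ _ _ _).
Qed.

Lemma perturb_seq_le eps s w K : 0 <= eps <= 1 -> (forall S, 0 <= w S <= K) ->
  forall S, perturb_seq eps s w S <= K.
Proof.
move=> /andP[e0 e1] wK; elim: s => [|e s IH] S /=; first by case/andP: (wK S).
rewrite ge_max IH /=; apply: le_trans (IH (flip e S)).
rewrite ler_piMl //; apply: le_trans (perturb_seq_ge _ _ _ _).
by case/andP: (wK (flip e S)).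
Qed.

Lemma perturb_seq_close eps s w K : 0 <= eps <= 1 -> (forall S, 0 <= w S <= K) ->
  forall S, perturb_seq eps s w S <= w S + (size s)%:R * K * eps.
Proof.
move=> he wK; have /andP[e0 e1] := he.
have K0 : 0 <= K by have /andP[h1 h2] := wK set0; apply: le_trans h2.
elim: s => [|e s IH] S /=; first by rewrite !mul0r addr0.
rewrite ge_max -natr1 !mulrDl mul1r addrA; apply/andP; split.
  by apply: le_trans (IH S) _; rewrite lerDl mulr_ge0.
apply: (@le_trans _ _ (K * eps)).
  by rewrite mulrC ler_wpM2r // perturb_seq_le.
rewrite lerDr addr_ge0 ?mulr_ge0 ?ler0n //.
by case/andP: (wK S).
Qed.

(** Flipping the elements at which [S] and [S0] differ leads to [S0], at the cost of one factor
    [eps] each. *)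
Lemma perturb_seq_gt0 eps s w S0 : 0 < eps -> 0 < w S0 ->
  forall S, (forall x, (x \in S) (+) (x \in S0) -> x \in s) ->
  0 < perturb_seq eps s w S.
Proof.
move=> e0 wS0; elim: s => [|e s IH] S sub /=.
  suff -> : S = S0 by [].
  apply/setP => x; have : ~~ ((x \in S) (+) (x \in S0)) by apply/negP => /sub.
  by case: (x \in S) (x \in S0) => [] [].
rewrite lt_max; have [eS|eS] := boolP ((e \in S) (+) (e \in S0)).
  apply/orP; right; rewrite mulr_gt0 // IH // => x; rewrite inE.
  have [->|xe] := eqVneq x e; first by rewrite addbT addNb eS.
  by rewrite addbF => /sub; rewrite inE (negPf xe).
apply/orP; left; apply: IH => x hx; have := sub x hx; rewrite inE.
by have [xe|//] := eqVneq x e; rewrite -xe hx in eS.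
Qed.

End Perturbation.

Lemma le_of_le_addeps (F : realFieldType) (a b c : F) :
  (forall eps, 0 < eps -> eps <= 1 -> a <= b + c * eps) -> a <= b.
Proof.
move=> h; rewrite leNgt; apply/negP => ba.
have c0 : 0 < c by have := h 1 ltr01 (lexx _); lra.
pose eps := Num.min 1 ((a - b) / (2 * c)).
have e0 : 0 < eps by rewrite lt_min ltr01 divr_gt0 ?subr_gt0 // mulr_gt0.
have e1 : eps <= 1 by rewrite ge_min lexx.
have e2 : eps * (2 * c) <= a - b by rewrite -ler_pdivlMr ?mulr_gt0 // ge_min lexx orbT.
have := h eps e0 e1; nra.
Qed.

(** * The inequality for nonnegative weights *)

Section ReflectSum.
Variables (F : realFieldType) (T : finType) (w : {set T} -> F).
Variables (A U0 : {set T}) (p : nat).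
Local Notation co := (reflect_set A U0).

(** For [A] inside [U0], the coefficient of x^m in the product of the parts of degrees q and
    [#|A| + #|U0| - q] of the sum of v(S) x^S, where m is 2 on [A], 1 on the rest of [U0] and 0
    elsewhere. *)
Definition reflect_sum (v : {set T} -> F) q : F :=
  \sum_(S : {set T} | [&& A \subset S, S \subset U0 & #|S| == q]) v S * v (co S).

Hypotheses (w_ge0 : forall S, 0 <= w S) (w_conc : Mnat_weight w).
Hypotheses (subA : A \subset U0) (cardAU : (#|A| + #|U0| = p.+1.*2)%N).

Lemma reflect_sum_le :
  (1 + p.+1%:R^-1) * reflect_sum w p <= reflect_sum w p.+1.
Proof.
have sum_ge0 v q : (forall S, 0 <= v S) -> 0 <= reflect_sum v q.
  by move=> v0; apply: sumr_ge0 => S _; rewrite mulr_ge0.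
have [S0 wS0|w0] := pickP (fun S => 0 < w S); last first.
  have w0' S : w S = 0.
    by apply/eqP; rewrite eq_le w_ge0 andbT leNgt w0.
  by rewrite /reflect_sum !big1 ?mulr0 // => S _; rewrite w0' mul0r.
have leAU := subset_leq_card subA.
have [r er] : exists r, (#|A| + r = p.+1)%N by exists (p.+1 - #|A|)%N; lia.
have cU : (#|U0| = r + p.+1)%N by lia.
(* If [r = 0], then [A] has p + 1 elements and no set of size p contains it. *)
have [r0|r_gt0] := posnP r.
  rewrite {1}/reflect_sum big1 ?mulr0 ?sum_ge0 // => S /and3P[AS _ /eqP cS].
  by have := subset_leq_card AS; lia.
have main : r.+1%:R * reflect_sum w p <= r%:R * reflect_sum w p.+1.
  pose K := \sum_(S : {set T}) w S.
  have wK S : 0 <= w S <= K.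
    by rewrite w_ge0 /K (bigD1 S) //= lerDl sumr_ge0.
  have K0 : 0 <= K by apply: sumr_ge0.
  pose n : F := (size (enum T))%:R.
  pose N : F := \sum_(S : {set T} | [&& A \subset S, S \subset U0 & #|S| == p.+1]) 1.
  (* Each of the [N] products for the perturbed weight exceeds that for [w] by at most
     [2 * K * (n * K) * eps]. *)
  apply: (@le_of_le_addeps _ _ _ (r%:R * (N * (2 * K * (n * K))))) => eps e0 e1.
  pose v := perturb_seq eps (enum T) w.
  have he : 0 <= eps <= 1 by rewrite ltW.
  have wv S : w S <= v S by apply: perturb_seq_ge.
  have v0 S : 0 < v S.
    by apply: (perturb_seq_gt0 e0 wS0) => x _; rewrite mem_enum.
  have vK S : v S <= K by apply: perturb_seq_le.
  have vw S : v S <= w S + n * K * eps by apply: perturb_seq_close.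
  have vconc : Mnat_weight v by apply: Mnat_perturb_seq.
  apply: (@le_trans _ _ (r.+1%:R * reflect_sum v p)).
    by rewrite ler_wpM2l ?ler0n // ler_sum // => S _; apply: ler_pM.
  apply: (le_trans (reflect_sum_le_pos subA r_gt0 cU er v0 vconc)).
  rewrite -mulrA -mulrDr ler_wpM2l ?ler0n // -mulrA mulr_suml -big_split /=.
  apply: ler_sum => S _; rewrite mul1r.
  have d0 : 0 <= n * K * eps by rewrite !mulr_ge0 ?ler0n // ltW.
  have a1 := ler_wpM2l (ltW (v0 S)) (vw (co S)).
  have a2 := ler_wpM2r (w_ge0 (co S)) (vw S).
  have a3 := ler_wpM2r d0 (vK S).
  have /andP[_ wKc] := wK (co S); have a4 := ler_wpM2r d0 wKc.
  rewrite mulrDr in a1; rewrite mulrDl in a2; rewrite [_ * w (co S)]mulrC in a2.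
  lra.
set a := reflect_sum w p in main *; set b := reflect_sum w p.+1 in main *.
have a0 : 0 <= a by apply: sum_ge0.
have k0 : 0 < p.+1%:R :> F by rewrite ltr0n.
have rr0 : 0 < r%:R :> F by rewrite ltr0n.
(* With k = p + 1, the factor (r + 1) / r from [main] is at least 1 + 1/k because r <= k. *)
have rk : r%:R <= p.+1%:R :> F by rewrite ler_nat; lia.
have -> : (1 + p.+1%:R^-1) * a = (p.+1%:R + 1) * a / p.+1%:R.
  by rewrite mulrAC [(_ + 1) / _]mulrDl divff ?lt0r_neq0 // mul1r.
rewrite ler_pdivrMr // -(ler_pM2l rr0); move: main; rewrite -natr1.
move: k0 rr0 rk; set k : F := p.+1%:R; set rr : F := r%:R => k0 rr0 rk main.
have := ler_wpM2l (ltW k0) main; have := ler_wpM2r a0 rk; lra.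
Qed.

End ReflectSum.

(** * Coefficients of products as sums over pairs of sets *)

Section Coefficients.
Variables (n : nat).
Implicit Types (S : {set 'I_n}) (m : 'X_{1..n}).

Definition mnm_set S : 'X_{1..n} := [multinom (i \in S : nat) | i < n].

Lemma prod_mnm_set S : \prod_(i in S) 'X_i = 'X_[mnm_set S] :> {mpoly R[n]}.
Proof.
rewrite mpolyXE_id big_mkcond; apply: eq_bigr => i _.
by rewrite mnmE; case: ifP; rewrite ?expr1 ?expr0.
Qed.

Lemma mcoeff_IpolyM q (nu : {set 'I_n} -> extR) k l m :
  (Ipoly q nu k * Ipoly q nu l)@_m =
  \sum_(S : {set 'I_n} | #|S| == k) \sum_(S' : {set 'I_n} | #|S'| == l)
    qpow q (nu S) * qpow q (nu S') * (mnm_set S + mnm_set S' == m)%MM%:R.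
Proof.
rewrite /Ipoly mulr_suml raddf_sum; apply: eq_bigr => S _ /=.
rewrite mulr_sumr raddf_sum; apply: eq_bigr => S' _ /=.
by rewrite -scalerAl -scalerAr scalerA !prod_mnm_set -mpolyXD mcoeffZ mcoeffX.
Qed.

(** A sum of two indicators is 2 exactly on the intersection and positive exactly on the union, so
    [S] and [m] determine [S']. *)
Lemma mnm_set_addE S S' m (A := [set i | (1 < m i)%N]) (U := [set i | (0 < m i)%N]) :
  (mnm_set S + mnm_set S' == m)%MM =
  [&& [forall i, m i <= 2]%N, A \subset S, S \subset U & S' == reflect_set A U S].
Proof.
apply/eqP/and4P.
  move=> /mnmP e; have e' i : m i = ((i \in S) + (i \in S'))%N.
    by rewrite -e mnmDE !mnmE.
  split.
  - by apply/forallP => i; rewrite e'; do 2!case: (_ \in _).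
  - by apply/subsetP => i; rewrite inE e'; do 2!case: (_ \in _).
  - by apply/subsetP => i; rewrite inE e'; do 2!case: (_ \in _).
  - by apply/eqP/setP => i; rewrite !inE e'; do 2!case: (_ \in _).
case=> /forallP m2 /subsetP AS /subsetP SU /eqP->; apply/mnmP => i.
rewrite mnmDE !mnmE !inE; have := m2 i; have := AS i; have := SU i.
rewrite !inE; case: (i \in S) => [/(_ isT)|_]; case: (m i) => [|[|[|x]]] //=.
by move=> /(_ isT).
Qed.

End Coefficients.

(** * The weights q^-nu and the coefficientwise inequality *)

Lemma qpow_ge0 q v : 0 <= qpow q v.
Proof. by case: v => [x|] //=; apply/ltW/RltP; exact: Exp_prop.exp_pos. Qed.

Lemma le_exp (x y : R) : x <= y -> Rtrigo_def.exp x <= Rtrigo_def.exp y.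
Proof.
rewrite le_eqVlt => /orP[/eqP->//|/RltP xy]; apply/ltW/RltP.
exact: Rpower.exp_increasing.
Qed.

Lemma ln_le0 (q : R) : 0 < q -> q <= 1 -> Rpower.ln q <= 0.
Proof.
move=> q0; rewrite le_eqVlt => /orP[/eqP->|/RltP q1].
  by rewrite Rpower.ln_1; exact: lexx.
apply/ltW/RltP; have /RltP qR := q0.
by have := Rpower.ln_increasing _ _ qR q1; rewrite Rpower.ln_1.
Qed.

(** The map x to q^-x = exp(-x ln q) is nondecreasing, as ln q <= 0, and turns sums into products;
    -oo gives weight 0. *)
Lemma Mnat_weight_qpow (n : nat) (nu : {set 'I_n} -> extR) q :
  0 < q -> q <= 1 -> Mnat_concave nu -> Mnat_weight (fun S => qpow q (nu S)).
Proof.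
move=> q0 q1 Hnu.
have mono a b c d : ele (eadd a b) (eadd c d) ->
    qpow q a * qpow q b <= qpow q c * qpow q d.
  case: a => [a|]; last by rewrite mul0r mulr_ge0 ?qpow_ge0.
  case: b => [b|]; last by rewrite mulr0 mulr_ge0 ?qpow_ge0.
  case: c d => [c|] [d|] //= h.
  rewrite /Rpower.Rpower !expRD; apply: le_exp.
  rewrite -[leLHS]/(- a * Rpower.ln q + - b * Rpower.ln q).
  rewrite -[leRHS]/(- c * Rpower.ln q + - d * Rpower.ln q).
  by rewrite -!mulrDl -!opprD ler_wnM2r ?ln_le0 // lerN2.
by move=> I1 I2 i /Hnu[/mono|[j jI /mono]]; [left|right; exists j].
Qed.

Theorem theorem1p6 (n : nat) (nu : {set 'I_n} -> extR)
  (Hnu : Mnat_concave nu) (Hdom : dom_nonempty nu)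
  (k : nat) (q : R) :
  (0 < k)%N -> (k < n)%N -> 0 < q -> q <= 1 ->
  coef_ge (Ipoly q nu k ^+ 2)
          ((1 + k%:R^-1) *: (Ipoly q nu k.-1 * Ipoly q nu k.+1)).
Proof.
case: k => // p _ _ q0 q1 m /=.
pose A := [set i | (1 < m i)%N]; pose U := [set i | (0 < m i)%N].
pose w S := qpow q (nu S).
have subA : A \subset U by apply/subsetP => i; rewrite !inE => /ltnW.
rewrite expr2 mcoeffZ !mcoeff_IpolyM.
have [m2|m2] := boolP [forall i, m i <= 2]%N; last first.
  rewrite !big1 ?mulr0 // => S _; rewrite big1 // => S' _;
  by rewrite mnm_set_addE (negPf m2) mulr0.
(* For fixed [S] only its reflection contributes, and its size is [b] exactly when the total degree
   fits. *)
have coefE a b : \sum_(S : {set 'I_n} | #|S| == a) \sum_(S' : {set 'I_n} | #|S'| == b)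
    w S * w S' * (mnm_set S + mnm_set S' == m)%MM%:R =
    if (#|A| + #|U| == a + b)%N then reflect_sum A U w a else 0.
  have -> : \sum_(S : {set 'I_n} | #|S| == a) \sum_(S' : {set 'I_n} | #|S'| == b)
    w S * w S' * (mnm_set S + mnm_set S' == m)%MM%:R =
    \sum_(S : {set 'I_n} | #|S| == a) if (A \subset S) && (S \subset U) then
       (if #|reflect_set A U S| == b then w S * w (reflect_set A U S) else 0) else 0.
    apply: eq_bigr => S _; have [/andP[AS SU]|nS] := boolP (_ && _); last first.
      by rewrite big1 // => S' _; rewrite mnm_set_addE m2 /= andbA (negPf nS) mulr0.
    rewrite big_mkcond (bigD1 (reflect_set A U S)) //= big1 => [|S' ne].
      by rewrite addr0 mnm_set_addE m2 AS SU eqxx mulr1.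
    by rewrite mnm_set_addE (negPf ne) !andbF mulr0 if_same.
  rewrite /reflect_sum -big_mkcondr; case: eqP => [e|ne].
    under eq_bigl => S do rewrite andbC -andbA.
    apply: eq_bigr => S /and3P[AS SU /eqP cS]; rewrite ifT //.
    by have := card_reflect AS SU; rewrite cS e => /addnI ->.
  apply: big1 => S /and3P[/eqP cS AS SU]; case: eqP => // cS'.
  by have := card_reflect AS SU; rewrite cS cS' => /esym/ne.
(* Since p + (p + 2) = (p + 1) + (p + 1), both sides carry the same degree condition. *)
rewrite !coefE addnS -addSn; case: eqP => [e|_]; last by rewrite mulr0.
apply: reflect_sum_le => //; first by move=> S; apply: qpow_ge0.
  exact: Mnat_weight_qpow.
by rewrite e addnn.
Qed.
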